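(* For all integers $0\le k\le n$, $$|\mathcal{I}_{n,k}| = |\mathcal{T}'_{n,k}| = \left\langle\!\left\langle{n\atop n-k}\right\rangle\!\right\rangle,$$ where $\mathcal{I}_{n,k}$ is the set of increasing ordered trees on the vertex set $[n]\cup\{0\}$ with exactly $k$ internal vertices, and $\mathcal{T}'_{n,k}$ is the set of increasing ternary trees on the vertex set $[n]\cup\{0\}$ that have exactly $k$ left edges and in which the only edge (if any) emanating from the root $0$ is a left edge.
   Context: An ordered tree is a rooted tree in which the children of each vertex are linearly ordered; it is increasing if its vertices carry distinct integer labels with each vertex larger than its parent. A vertex is internal if it has at least one child, and a leaf otherwise (so for $n=0$ the single-vertex tree has no internal vertex). A ternary tree is either empty, or a root together with an ordered list of three ternary subtrees (left, middle, right), each possibly empty; an edge from a vertex to the root of its left (middle, right) subtree is a left (middle, right) edge. It is increasing if each vertex has a larger label than its parent. The second-order Eulerian number $\left\langle\!\left\langle{n\atop j}\right\rangle\!\right\rangle$ is the number of Stirling permutations of size $n$ with exactly $j$ ascents. Here a Stirling permutation of size $n$ is a word that is a permutation of the multiset $\{1,1,2,2,\ldots,n,n\}$ in which, for every $i$, all entries between the two occurrences of $i$ exceed $i$; an ascent of $w_1\cdots w_{2n}$ is an index $1\le i\le 2n-1$ with $w_i<w_{i+1}$. For $n=0$ it equals $\delta_{j0}$. *)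

(* Defs.v *)
From mathcomp Require Import all_boot.
From mathcomp Require Import classical_sets functions cardinality.

Set Implicit Arguments.
Unset Strict Implicit.
Unset Printing Implicit Defensive.

Local Open Scope classical_set_scope.

Inductive otree := ONode of nat & seq otree.

Definition oroot (t : otree) : nat := let: ONode x _ := t in x.

Fixpoint olabels (t : otree) : seq nat :=
  let: ONode x ts := t in x :: flatten (map olabels ts).

Fixpoint olarger_than_parent (t : otree) : bool :=
  let: ONode x ts := t in
  all (fun c => (x < oroot c) && olarger_than_parent c) ts.

Definition oincreasing (t : otree) : bool :=
  uniq (olabels t) && olarger_than_parent t.

Fixpoint ointernal (t : otree) : nat :=
  let: ONode _ ts := t in (0 < size ts) + sumn (map ointernal ts).

Definition inc_otrees (n k : nat) : set otree :=
  [set t | [/\ oincreasing t,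
               perm_eq (olabels t) (iota 0 n.+1) &
               ointernal t = k]].

Inductive ttree := TEmpty | TNode of nat & ttree & ttree & ttree.

Definition tempty (t : ttree) : bool := if t is TEmpty then true else false.

Fixpoint tlabels (t : ttree) : seq nat :=
  if t is TNode x l m r then x :: tlabels l ++ tlabels m ++ tlabels r else [::].

Definition troot_gt (x : nat) (t : ttree) : bool :=
  if t is TNode y _ _ _ then x < y else true.

Fixpoint tincreasing (t : ttree) : bool :=
  if t is TNode x l m r then
    [&& troot_gt x l, troot_gt x m, troot_gt x r,
        tincreasing l, tincreasing m & tincreasing r]
  else true.

Fixpoint tleft_edges (t : ttree) : nat :=
  if t is TNode _ l m r then
    ~~ tempty l + tleft_edges l + tleft_edges m + tleft_edges r
  else 0.

Definition troot_left_only (t : ttree) : bool :=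
  if t is TNode _ _ m r then tempty m && tempty r else true.

(* The root of a tree satisfying the first two conditions is labelled 0. *)
Definition inc_ttrees' (n k : nat) : set ttree :=
  [set t | [/\ tincreasing t,
               perm_eq (tlabels t) (iota 0 n.+1),
               tleft_edges t = k &
               troot_left_only t]].

(* The letter 0 of the alphabet 'I_n.+1 never occurs, by the first conjunct. *)
Definition stirling_perm (n : nat) (w : n.*2.-tuple 'I_n.+1) : bool :=
  perm_eq (map val w) (flatten [seq [:: i; i] | i <- iota 1 n]) &&
  [forall a : 'I_n.*2, forall b : 'I_n.*2, forall c : 'I_n.*2,
     [&& a < b, b < c & tnth w a == tnth w c] ==> (tnth w a < tnth w b)].

(* Positions are counted from 0, so an ascent i satisfies i + 1 < 2n. *)
Definition ascents (n : nat) (w : n.*2.-tuple 'I_n.+1) : nat :=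
  #|[set i : 'I_n.*2 | (i.+1 < n.*2) && (nth ord0 w i < nth ord0 w i.+1)]%SET|.

Definition eulerian2 (n j : nat) : nat :=
  #|[set w : n.*2.-tuple 'I_n.+1 | stirling_perm w && (ascents w == j)]%SET|.

(* Main.v *)
(* A ternary tree with root x and subtrees l, m, r encodes the ordered forest
   F(m), x[F(l)], F(r), where x[F(l)] is the tree with root x over F(l), and the
   word W(l) x W(m) x W(r).  On increasing trees x is the least root of the
   forest and the least letter of the word, so both encodings can be inverted
   by splitting at the minimum.  Left edges of the tree become internal vertices
   of the forest, while ascents of the word correspond to middle and right
   edges.  Deleting the root 0 of a tree in [inc_ttrees' n k] and applying F or W
   to its left subtree gives the two bijections. *)

Require Import Defs.
From mathcomp Require Import all_boot.
From mathcomp Require Import classical_sets functions cardinality.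
From mathcomp Require Import zify.

Local Open Scope classical_set_scope.
Local Open Scope card_scope.

Set Implicit Arguments.
Unset Strict Implicit.
Unset Printing Implicit Defensive.

(** * Splitting sequences at an element, and subsequences *)

(** On either side the marked element is the first one with key [f a], so both marks stand at the
    same position. The key is [oroot] for forests and [id] for words. *)
Lemma cat_cons_inj (T : Type) (f : T -> nat) A a B A' a' B' :
  f a = f a' -> f a \notin map f A -> f a \notin map f A' ->
  A ++ a :: B = A' ++ a' :: B' -> [/\ A = A', a = a' & B = B'].
Proof.
move=> eqf; elim: A A' => [|b A IH] [|b' A'] //=; rewrite ?inE ?negb_or.
- by move=> _ _ [-> ->].
- by move=> _ /andP[/eqP ne _] [e _]; rewrite e in ne.
- by move=> /andP[/eqP ne _] _ [e _]; rewrite e -eqf in ne.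
- by move=> /andP[_ nA] /andP[_ nA'] [<- /(IH _ nA nA')[<- <- <-]].
Qed.

Lemma min_split (T : Type) (f : T -> nat) (s : seq T) : 0 < size s ->
  exists A a B, s = A ++ a :: B /\ all (leq (f a)) (map f (A ++ B)).
Proof.
elim: s => // b [|c s] IH _; first by exists [::], b, [::].
have [A [a [B [-> minA]]]] := IH isT.
have [le_ba|lt_ab] := leqP (f b) (f a); last first.
  by exists (b :: A), a, B; rewrite /= (ltnW lt_ab).
exists [::], b, (A ++ a :: B); split=> //=.
have: all (leq (f b)) (map f (A ++ B)).
  by apply: sub_all minA => x; apply: leq_trans.
by rewrite !map_cat !all_cat /= le_ba.
Qed.

Lemma split_first (T : eqType) (x : T) (s : seq T) : x \in s ->
  exists A B, s = A ++ x :: B /\ x \notin A.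
Proof.
elim: s => // y s IH; rewrite inE; have [<- _|ne /= /IH[A [B [-> nA]]]] := eqVneq x y.
  by exists [::], s.
by exists (y :: A), B; rewrite inE negb_or ne.
Qed.

(** Used to pass between the positions in [stirling_perm] and the patterns in [stirling_word], one
    letter at a time. *)
Lemma subseq_consP {T : eqType} (x0 x : T) (p s : seq T) :
  reflect (exists i, [/\ i < size s, nth x0 s i = x & subseq p (drop i.+1 s)])
          (subseq (x :: p) s).
Proof.
apply: (iffP idP) => [|[i [lt_i <- sub_p]]]; last first.
  rewrite -[in X in subseq _ X](cat_take_drop i s) (drop_nth x0 lt_i).
  by apply: subseq_trans (suffix_subseq _ _); rewrite /= eqxx.
elim: s => // y s IH /=; have [<- sub_p|_ /IH[i [lt_i eq_i sub_p]]] := eqVneq x y.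
  by exists 0; rewrite drop0.
by exists i.+1.
Qed.

(** The last letter of the pattern can only be matched inside [l], and therefore so are all letters
    before it. The next lemma is the mirror image. *)
Lemma subseq_rcons_catl {T : eqType} (a : T) (s l r : seq T) :
  a \notin r -> subseq (rcons s a) (l ++ r) -> subseq (rcons s a) l.
Proof.
elim: l s => [|b l IH] s nr /=.
  by move=> /mem_subseq/(_ a); rewrite mem_rcons mem_head (negPf nr) => /(_ isT).
case: s => [|c s] /=; case: ifP => _; rewrite ?sub0seq //.
- exact: (IH [::]).
- exact: IH.
- exact: (IH (c :: s)).
Qed.

Lemma subseq_cons_catr {T : eqType} (a : T) (s l r : seq T) :
  a \notin l -> subseq (a :: s) (l ++ r) -> subseq (a :: s) r.
Proof.
by elim: l => //= b l IH; rewrite inE negb_or => /andP[/negPf-> /IH].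
Qed.

(** * The encodings F and W, and the labels of increasing trees *)

Fixpoint tforest (t : ttree) : seq otree :=
  if t is TNode x l m r then tforest m ++ ONode x (tforest l) :: tforest r
  else [::].

Fixpoint tword (t : ttree) : seq nat :=
  if t is TNode x l m r then tword l ++ x :: tword m ++ x :: tword r
  else [::].

Lemma perm_tforest t : perm_eq (flatten (map olabels (tforest t))) (tlabels t).
Proof.
elim: t => //= x l IHl m IHm r IHr; apply/permP => p.
move/permP/(_ p): IHl; move/permP/(_ p): IHm; move/permP/(_ p): IHr.
rewrite map_cat flatten_cat /= !(count_cat, count_flatten) /=.
rewrite !(count_cat, count_flatten) /= ; lia.
Qed.

Lemma perm_tword t : perm_eq (tword t) (tlabels t ++ tlabels t).
Proof.
elim: t => //= x l IHl m IHm r IHr; apply/permP => p.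
move/permP/(_ p): IHl; move/permP/(_ p): IHm; move/permP/(_ p): IHr.
do 4?rewrite /= ?count_cat.
lia.
Qed.

Lemma mem_tword t : tword t =i tlabels t.
Proof. by move=> y; rewrite (perm_mem (perm_tword t)) mem_cat orbb. Qed.

Lemma tlabels_gt x t : tincreasing t -> troot_gt x t -> all (ltn x) (tlabels t).
Proof.
elim: t x => //= y l IHl m IHm r IHr x.
move=> /and5P[gtl gtm gtr incl /andP[incm incr]] lt_xy.
have gt_x z : y < z -> x < z by apply: ltn_trans.
rewrite lt_xy !all_cat /=.
by rewrite !(sub_all gt_x) // ?(IHl, IHm, IHr).
Qed.

Lemma troot_gt_all x t : all (ltn x) (tlabels t) -> troot_gt x t.
Proof. by case: t => //= y l m r /andP[]. Qed.

Lemma oroot_olabels ts : {subset map oroot ts <= flatten (map olabels ts)}.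
Proof.
elim: ts => //= -[x cs] ts IH y; rewrite !inE mem_cat.
by case/predU1P => [->|/IH->]; rewrite ?eqxx ?orbT.
Qed.

Lemma troot_gt_tforest x t :
  all (ltn x) (map oroot (tforest t)) -> troot_gt x t.
Proof. by case: t => //= y l m r; rewrite map_cat all_cat /= => /and3P[]. Qed.

Lemma tnode_uniq x l m r : uniq (tlabels (TNode x l m r)) ->
  [/\ uniq (tlabels l), uniq (tlabels m) & uniq (tlabels r)].
Proof. by rewrite /= !cat_uniq => /and5P[_ -> _ -> /andP[_ ->]]. Qed.

Lemma tnode_head_notin {x l m r} : uniq (tlabels (TNode x l m r)) ->
  [/\ x \notin tlabels l, x \notin tlabels m & x \notin tlabels r].
Proof. by rewrite /= !mem_cat !negb_or => /andP[/and3P[]]. Qed.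

Lemma tnode_min x l m r y : tincreasing (TNode x l m r) ->
  y \in tlabels (TNode x l m r) -> x <= y.
Proof.
move=> inc; rewrite /= inE => /predU1P[->//|y_in].
move: inc => /= /and5P[gtl gtm gtr incl /andP[incm incr]].
have: all (ltn x) (tlabels l ++ tlabels m ++ tlabels r).
  by rewrite !all_cat !tlabels_gt.
by move=> /allP/(_ _ y_in)/ltnW.
Qed.

Lemma tincreasing_node_inv x l m r : tincreasing (TNode x l m r) ->
  [/\ tincreasing l, tincreasing m & tincreasing r].
Proof. by move=> /= /and5P[_ _ _ ? /andP[? ?]]. Qed.

(** The root of an increasing tree is its least label, hence determined by the set of labels. *)
Lemma tnode_root_eq x l m r x' l' m' r' :
  tincreasing (TNode x l m r) -> tincreasing (TNode x' l' m' r') ->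
  tlabels (TNode x l m r) =i tlabels (TNode x' l' m' r') -> x = x'.
Proof.
move=> inc inc' eql; apply/eqP; rewrite eqn_leq.
by rewrite (tnode_min inc) ?(tnode_min inc') ?eql ?mem_head //
   -eql mem_head.
Qed.

(** * Injectivity of F and W *)

(** The labels of the forest determine [x]. As [x] is not a root of F(m), the tree with root [x]
    cuts the forest in a unique way. *)
Lemma tforest_inj t t' : tincreasing t -> tincreasing t' ->
  uniq (tlabels t) -> uniq (tlabels t') -> tforest t = tforest t' -> t = t'.
Proof.
elim: t t' => [|x l IHl m IHm r IHr] [|x' l' m' r'] // inc inc' u u'.
- by move=> /(congr1 size); rewrite /= size_cat /= addnS.
- by move=> /(congr1 size); rewrite /= size_cat /= addnS.
move=> eqf; have eqx : x = x'.
  apply: tnode_root_eq inc inc' _ => y.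
  by rewrite -(perm_mem (perm_tforest _)) eqf (perm_mem (perm_tforest _)).
have nroot z s : z \notin tlabels s -> z \notin map oroot (tforest s).
  by apply: contra => /oroot_olabels; rewrite (perm_mem (perm_tforest _)).
have [_ nm _] := tnode_head_notin u; have [_ nm' _] := tnode_head_notin u'.
have [incl incm incr] := tincreasing_node_inv inc.
have [incl' incm' incr'] := tincreasing_node_inv inc'.
have [ul um ur] := tnode_uniq u.
have [ul' um' ur'] := tnode_uniq u'.
have [|||eqm [_ eql] eqr] := cat_cons_inj (f := oroot) _ _ _ eqf => //=.
- exact: nroot.
- by rewrite eqx; apply: nroot.
by rewrite eqx (IHl l') // (IHm m') // (IHr r').
Qed.

(** Two cuts are needed here: the first [x] ends W(l) and the second ends W(m). *)
Lemma tword_inj t t' : tincreasing t -> tincreasing t' ->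
  uniq (tlabels t) -> uniq (tlabels t') -> tword t = tword t' -> t = t'.
Proof.
elim: t t' => [|x l IHl m IHm r IHr] [|x' l' m' r'] // inc inc' u u'.
- by move=> /(congr1 size); rewrite /= size_cat /= addnS.
- by move=> /(congr1 size); rewrite /= size_cat /= addnS.
move=> eqw; have eqx : x = x'.
  by apply: tnode_root_eq inc inc' _ => y; rewrite -!mem_tword eqw.
have [nl nm _] := tnode_head_notin u; have [nl' nm' _] := tnode_head_notin u'.
have [incl incm incr] := tincreasing_node_inv inc.
have [incl' incm' incr'] := tincreasing_node_inv inc'.
have [ul um ur] := tnode_uniq u.
have [ul' um' ur'] := tnode_uniq u'.
have [||eql _ eqmr] := cat_cons_inj (f := id) eqx _ _ eqw.
- by rewrite map_id mem_tword.
- by rewrite map_id mem_tword eqx.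
have [||eqm _ eqr] := cat_cons_inj (f := id) eqx _ _ eqmr.
- by rewrite map_id mem_tword.
- by rewrite map_id mem_tword eqx.
by rewrite eqx (IHl l') // (IHm m') // (IHr r').
Qed.

(** * Surjectivity of F onto increasing forests and of W onto Stirling words *)

(** Strong induction on the number of labels. The forest is cut at the tree with the least root: the
    trees before it give [m], its children give [l], and the trees after it give [r]. *)
Lemma tforest_surj ts : uniq (flatten (map olabels ts)) ->
  all olarger_than_parent ts -> exists2 t, tincreasing t & tforest t = ts.
Proof.
have [N] := ubnP (size (flatten (map olabels ts))).
elim: N ts => // N IH [|c ts] leN; first by exists TEmpty.
have [//|A [[x cs] [B [eqts minx]]]] := min_split oroot (s := c :: ts).
rewrite {c ts}eqts in leN *; move: leN.
rewrite map_cat flatten_cat /= !size_cat /= size_cat => leN.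
rewrite cat_uniq /= negb_or has_cat negb_or mem_cat negb_or cat_uniq.
move=> /and3P[uA /and3P[nxA _ _] /andP[/andP[nxcs nxB] /and3P[ucs _ uB]]].
rewrite all_cat /= => /and3P[incA inccs incB].
move: minx; rewrite /= map_cat all_cat => /andP[minA minB].
(* The chosen root is only weakly minimal; distinctness of the labels makes the inequality
   strict. *)
have strict ds : x \notin flatten (map olabels ds) ->
    all (leq x) (map oroot ds) -> all (ltn x) (map oroot ds).
  move=> nx /allP mins; apply/allP => y y_in; rewrite /= ltn_neqAle mins //.
  by rewrite andbT; apply: contra nx => /eqP->; apply: oroot_olabels.
have olp_cs : all olarger_than_parent cs by apply: sub_all inccs => t /andP[].
have gt_cs : all (ltn x) (map oroot cs).
  by rewrite all_map; apply: sub_all inccs => t /andP[].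
have [ltcs ltA ltB] : [/\ size (flatten (map olabels cs)) < N,
    size (flatten (map olabels A)) < N & size (flatten (map olabels B)) < N].
  by clear -leN; split; lia.
have [l incl eql] : exists2 t, tincreasing t & tforest t = cs.
  exact: IH.
have [m incm eqm] : exists2 t, tincreasing t & tforest t = A.
  exact: IH.
have [r incr eqr] : exists2 t, tincreasing t & tforest t = B.
  exact: IH.
exists (TNode x l m r); last by rewrite /= eql eqm eqr.
by rewrite /= incl incm incr !troot_gt_tforest ?eql ?eqm ?eqr ?gt_cs ?strict.
Qed.

(** No alphabet is fixed, so that the factors obtained by cutting at the least letter are again
    Stirling words. *)
Definition stirling_word (w : seq nat) :=
  {in w, forall y, count_mem y w = 2} /\
  (forall a b, subseq [:: a; b; a] w -> a < b).

(** Subtrees have disjoint labels. If [a] is not the root label, a pattern [a b a] therefore lies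
    within the word of one subtree; if it is, then [b] lies in W(m) and exceeds the root. *)
Lemma tword_stirling t : tincreasing t -> uniq (tlabels t) ->
  stirling_word (tword t).
Proof.
move=> inc u; split=> [y|a b].
  rewrite mem_tword => y_in; rewrite (permP (perm_tword t)) count_cat.
  by rewrite !count_uniq_mem // y_in.
elim: t inc u => //= x l IHl m IHm r IHr inc u.
have [nl nm nr] := tnode_head_notin u; have [ul um ur] := tnode_uniq u.
have [incl incm incr] := tincreasing_node_inv inc.
have disj : {in tlabels l, forall y, y \notin tlabels m ++ tlabels r} /\
            {in tlabels m, forall y, y \notin tlabels r}.
  move: u; rewrite /= !cat_uniq => /and4P[_ _ /hasPn dl /and3P[_ /hasPn dr _]].
  by split=> y y_in; apply/negP; [move/dl | move/dr]; rewrite /= y_in.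
have [disjl disjm] := disj; have minx y := tnode_min (y := y) inc.
case: (eqVneq a x) => [->|ne_ax].
  move/subseq_cons_catr; rewrite mem_tword nl => /(_ isT) /=; rewrite eqxx.
  rewrite -(cat1s x (tword r)) catA => /(subseq_rcons_catl (s := [:: b])).
  rewrite mem_tword nr => /(_ isT); rewrite cats1.
  (* The case [b = x] would need three occurrences of the root label, which is written only
     twice. *)
  have [->|ne_bx] := eqVneq b x.
    rewrite -(cats1 (tword m)) => /(subseq_cons_catr (s := [:: x])).
    by rewrite mem_tword nm => /(_ isT); rewrite /= eqxx.
  move/mem_subseq/(_ b (mem_head _ _)); rewrite mem_rcons inE (negPf ne_bx) /=.
  rewrite mem_tword => b_in; rewrite ltn_neqAle eq_sym ne_bx minx //.
  by rewrite inE !mem_cat b_in !orbT.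
have [a_l|na_l] := boolP (a \in tlabels l).
  move: (disjl _ a_l); rewrite mem_cat negb_or => /andP[na_m na_r].
  move/(subseq_rcons_catl (s := [:: a; b])) => sub; apply: IHl => //; apply: sub.
  by rewrite !(inE, mem_cat) !mem_tword !negb_or ne_ax na_m na_r.
move/(subseq_cons_catr (s := [:: b; a])); rewrite mem_tword na_l => /(_ isT).
rewrite /= (negPf ne_ax).
have [a_m|na_m] := boolP (a \in tlabels m).
  move/(subseq_rcons_catl (s := [:: a; b])) => sub; apply: IHm => //; apply: sub.
  by rewrite inE mem_tword negb_or ne_ax disjm.
move/(subseq_cons_catr (s := [:: b; a])); rewrite mem_tword na_m => /(_ isT).
by rewrite /= (negPf ne_ax); apply: IHr.
Qed.

Lemma tword_uniq t : {in tword t, forall y, count_mem y (tword t) = 2} ->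
  uniq (tlabels t).
Proof.
move=> count2; apply: count_mem_uniq => y.
case: (boolP (y \in tlabels t)) => [|/count_memPn //] y_in.
have := count2 y; rewrite mem_tword y_in (permP (perm_tword t)) count_cat.
by move=> /(_ isT); lia.
Qed.

(** Strong induction on the length. The least letter [x] cuts the word as [A x B x C]. No other
    letter is shared by two factors, so each factor has both copies of its letters and is a Stirling
    word. *)
Lemma tword_surj w : stirling_word w -> exists2 t, tincreasing t & tword t = w.
Proof.
have [N] := ubnP (size w).
elim: N w => // N IH [|c w] leN; first by exists TEmpty.
have [//|A0 [x [B0 [eqw0 minx0]]]] := min_split id (s := c :: w).
have x_in : x \in c :: w by rewrite eqw0 mem_cat mem_head orbT.
have minx : {in c :: w, forall y, x <= y}.
  move=> y; rewrite eqw0 mem_cat inE => y_in.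
  case: (eqVneq y x) y_in => [->//|_ /= y_in].
  by move/allP: minx0; apply; rewrite map_id mem_cat.
(* The statement of [min_split] does not say which occurrence of the minimum it returns. Only
   minimality is kept, and the word is cut again at the first occurrence. *)
move: {c w eqw0 minx0 A0 B0} (c :: w) x_in minx leN.
move=> w /split_first[A [D [-> nxA]]] minx leN [count2 stir].
have cxD : count_mem x D = 1.
  have := count2 x; rewrite mem_cat mem_head orbT => /(_ isT).
  by rewrite count_cat /= eqxx (count_memPn nxA) => -[].
have /split_first[B [C [eqD nxB]]] : x \in D by rewrite -has_pred1 has_count cxD.
move: cxD; rewrite {D}eqD in minx leN count2 stir *.
rewrite count_cat /= eqxx (count_memPn nxB) => -[/count_memPn nxC].
have gtx y : y \in A ++ B ++ C -> x < y.
  rewrite !mem_cat ltn_neqAle => y_in; rewrite minx ?andbT; last first.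
    by move: y_in; rewrite !(mem_cat, inE) => /or3P[] ->; rewrite ?orbT.
  by apply: contraTneq y_in => <-; rewrite !negb_or nxA nxB.
(* A letter [y] on both sides of an [x] gives the pattern [y x y], hence [y < x], against the
   minimality of [x]. The same argument proves [nBC]. *)
have nAB y : y \in A -> y \notin B ++ x :: C.
  move=> yA; apply/negP => yBC; have := gtx y; rewrite mem_cat yA => /(_ isT).
  have /stir : subseq [:: y; x; y] (A ++ x :: B ++ x :: C).
    apply: (@cat_subseq _ [:: y] [:: x; y]); first by rewrite sub1seq.
    by rewrite /= eqxx sub1seq.
  by move=> /ltn_trans lt /lt; rewrite ltnn.
have nBC y : y \in B -> y \notin C.
  move=> yB; apply/negP => yC; have := gtx y.
  rewrite !mem_cat yB orbT => /(_ isT).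
  have /stir : subseq [:: y; x; y] (A ++ x :: B ++ x :: C).
    apply: (@cat_subseq _ [::]); rewrite ?sub0seq // -cat_cons.
    apply: (@cat_subseq _ [:: y] [:: x; y]); last by rewrite /= eqxx sub1seq.
    by rewrite sub1seq inE yB orbT.
  by move=> /ltn_trans lt /lt; rewrite ltnn.
have [ltA ltB ltC] : [/\ size A < N, size B < N & size C < N].
  by move: leN; clear; rewrite !size_cat /= size_cat /= => leN; split; lia.
have count_w y : y \in A ++ B ++ C ->
    count_mem y A + (count_mem y B + count_mem y C) = 2.
  move=> y_in; have ne_xy : x == y = false.
    by apply: contraTF (gtx _ y_in) => /eqP->; rewrite ltnn.
  rewrite -(count2 y) ?count_cat /= ?count_cat /= ?ne_xy //.
  by move: y_in; rewrite !(mem_cat, inE) => /or3P[] ->; rewrite ?orbT.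
have sub_stir s : subseq s (A ++ x :: B ++ x :: C) ->
    forall a b, subseq [:: a; b; a] s -> a < b.
  by move=> sub a b /subseq_trans/(_ sub)/stir.
have [l incl eql] : exists2 t, tincreasing t & tword t = A.
  apply: IH => //; split; last exact/sub_stir/prefix_subseq.
  move=> y yA; have := nAB _ yA; rewrite mem_cat inE !negb_or.
  case/and3P => /count_memPn cB _ /count_memPn cC.
  by rewrite -(count_w y) ?mem_cat ?yA // cB cC !addn0.
have [m incm eqm] : exists2 t, tincreasing t & tword t = B.
  apply: IH => //; split; last first.
    apply: sub_stir; apply: subseq_trans (suffix_subseq _ _).
    by apply: subseq_trans (subseq_cons _ _); apply: prefix_subseq.
  move=> y yB; have /count_memPn cC := nBC _ yB.
  have /count_memPn cA : y \notin A.
    by apply/negP => /nAB; rewrite mem_cat yB.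
  by rewrite -(count_w y) ?mem_cat ?yB ?orbT // cA cC addn0.
have [r incr eqr] : exists2 t, tincreasing t & tword t = C.
  apply: IH => //; split; last first.
    apply: sub_stir; apply: subseq_trans (suffix_subseq _ _).
    apply: subseq_trans (subseq_cons _ _); apply: subseq_trans (suffix_subseq _ _).
    exact: subseq_cons.
  move=> y yC.
  have /count_memPn cA : y \notin A.
    by apply/negP => /nAB; rewrite mem_cat inE yC !orbT.
  have /count_memPn cB : y \notin B by apply/negP => /nBC; rewrite yC.
  by rewrite -(count_w y) ?mem_cat ?yC ?orbT // cA cB.
exists (TNode x l m r); last by rewrite /= eql eqm eqr.
rewrite /= incl incm incr !troot_gt_all //; apply/allP => y;
  by rewrite -mem_tword ?eql ?eqm ?eqr => y_in; rewrite /= gtx // !mem_cat y_in ?orbT.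
Qed.

(** * Ascents of W(t) and left edges of t *)

(** Decides whether a root [y] written right after W(t) is an ascent: the preceding letter belongs
    to [t], and so exceeds [y], unless [t] is empty. *)
Lemma last_tword_lt x y t : all (ltn y) (tlabels t) ->
  (last x (tword t) < y) = tempty t && (x < y).
Proof.
case: t => // z l m r gty; apply/negbTE; rewrite -leqNgt ltnW //.
apply: (allP gty); rewrite -mem_tword /= last_cat /= mem_cat.
by rewrite mem_last orbT.
Qed.

(* In [W(l) y W(m) y W(r)] preceded by a letter smaller than [y], an ascent at
   the first [y] means that [l] is empty, and there is none at the second. *)
Lemma tword_ascents x t : tincreasing t -> troot_gt x t ->
  count id (pairmap ltn x (tword t)) + tleft_edges t = size (tlabels t).
Proof.
elim: t x => //= y l IHl m IHm r IHr x.
move=> /and5P[gtl gtm gtr incl /andP[incm incr]] lt_xy.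
rewrite !pairmap_cat /= !pairmap_cat /= !count_cat /= count_cat /= !size_cat.
rewrite !last_tword_lt ?tlabels_gt // ltnn andbF lt_xy andbT.
have lt_l : troot_gt x l by case: (l) gtl => //= z _ _ _; apply: ltn_trans.
rewrite -(IHl x) // -(IHm y) // -(IHr y) //; case: (tempty l) => /=; lia.
Qed.

(** * Stirling permutations as words of natural numbers *)

Lemma perm_cat_self (T : eqType) (s t : seq T) :
  perm_eq (s ++ s) (t ++ t) = perm_eq s t.
Proof.
apply/idP/idP => /permP eqst; apply/permP => p; have := eqst p;
  rewrite !count_cat; lia.
Qed.

Lemma perm_flatten_pairs (T : eqType) (s : seq T) :
  perm_eq (flatten [seq [:: i; i] | i <- s]) (s ++ s).
Proof.
by elim: s => //= x s IH; rewrite perm_cons perm_sym perm_catC /= perm_cons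
  perm_sym.
Qed.

(** Putting 0 in front of a nonempty word of positive letters creates exactly one new ascent. *)
Lemma ascentsE n (w : n.*2.-tuple 'I_n.+1) : 0 \notin map val w ->
  ascents w + (0 < n) = count id (pairmap ltn 0 (map val w)).
Proof.
case: n w => [|n] w w_pos.
  have /size0nil-> : size w = 0 by rewrite size_tuple.
  by rewrite /ascents eq_card0 // => -[].
have sz : size (map val w) = n.*2.+2 by rewrite size_map size_tuple.
have -> : ascents w = \sum_(i < n.*2.+2)
    ((i.+1 < n.*2.+2) && (nth ord0 w i < nth ord0 w i.+1)).
  rewrite /ascents -sum1dep_card big_mkcond; apply: eq_bigr => i _.
  by case: ifP.
rewrite -sum1_count (big_nth true) size_pairmap sz big_mkord [RHS]big_mkcond.
(* On the left the last position is never an ascent; on the right the first term compares 0 with the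
   first letter and gives the extra 1. *)
rewrite big_ord_recr /= ltnn addn0 addnC [RHS]big_ord_recl /=.
have nth_w i : i < n.*2.+2 -> nth 0 (map val w) i = nth ord0 w i.
  by move=> lt_i; rewrite (nth_map ord0) // size_tuple.
congr (_ + _).
  rewrite (nth_pairmap 0) ?sz //= lt0n ifT //.
  by apply: contraNneq w_pos => <-; rewrite mem_nth // sz.
apply: eq_bigr => i _; have lt_i := ltn_ord i.
rewrite (nth_pairmap 0) ?sz //= /bump /= !nth_w //; last by rewrite ltnW.
by rewrite ltnS lt_i; case: ifP.
Qed.

Lemma count_perm_double (T : eqType) (s t : seq T) (y : T) :
  uniq s -> perm_eq t (s ++ s) -> y \in t -> count_mem y t = 2.
Proof.
move=> us eqt; rewrite (perm_mem eqt) mem_cat orbb => y_in.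
by rewrite (permP eqt) count_cat count_uniq_mem // y_in.
Qed.

Lemma stirling_permP n (w : n.*2.-tuple 'I_n.+1) :
  reflect (perm_eq (map val w) (iota 1 n ++ iota 1 n) /\
           stirling_word (map val w))
          (stirling_perm w).
Proof.
have eqp : perm_eq (map val w) (flatten [seq [:: i; i] | i <- iota 1 n]) =
           perm_eq (map val w) (iota 1 n ++ iota 1 n).
  by rewrite (permPr (perm_flatten_pairs _)).
have sz : size (map val w) = n.*2 by rewrite size_map size_tuple.
have nth_w (i : 'I_n.*2) : nth 0 (map val w) i = tnth w i.
  by rewrite (nth_map (tnth_default w i)) ?size_tuple.
apply: (iffP andP) => [[]|[pw [_ stir]]]; rewrite eqp; last first.
  split=> //; apply/forallP => a; apply/forallP => b; apply/forallP => c.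
  apply/implyP => /and3P[lt_ab lt_bc /eqP eq_ac].
  have ltb := leq_ltn_trans lt_ab (ltn_ord b).
  apply: stir; apply/(subseq_consP 0); exists a; split; rewrite ?sz //.
  (* Position [b] of the word, counted in the suffix that starts after position [a]. *)
  apply/(subseq_consP 0); exists (b - a.+1); split.
  - by rewrite size_drop sz ltn_sub2r.
  - by rewrite nth_drop subnKC // nth_w.
  rewrite drop_drop sub1seq eq_ac -nth_w.
  have -> : (b - a.+1).+1 + a.+1 = b.+1 by rewrite addSn subnK.
  by rewrite -[X in nth _ _ X](subnKC lt_bc) -nth_drop mem_nth // size_drop sz
    ltn_sub2r // (leq_ltn_trans lt_bc).
move=> pw /forallP stir; split=> //; split=> [y|a b].
  exact/count_perm_double/pw/iota_uniq.
case/(subseq_consP 0) => i [lti <-] /(subseq_consP 0)[j []].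
rewrite size_drop nth_drop drop_drop => ltj <-.
rewrite sub1seq => /(nthP 0)[k]; rewrite size_drop nth_drop.
(* Back to absolute positions: [j] and [k] count within suffixes. *)
set b' := _ + j; set c := _ + k => ltk eq_ic.
have lt_bc : b' < c by rewrite /b' /c; lia.
have lt_ib : i < b' by rewrite /b'; lia.
have lt_c : c < n.*2 by move: ltk; rewrite sz /c; lia.
have lt_b := ltn_trans lt_bc lt_c; have lt_i := ltn_trans lt_ib lt_b.
move: (stir (Ordinal lt_i)).
move=> /forallP/(_ (Ordinal lt_b))/forallP/(_ (Ordinal lt_c))/implyP.
rewrite -(nth_w (Ordinal lt_i)) -(nth_w (Ordinal lt_b)) /=; apply.
by rewrite lt_ib lt_bc -val_eqE /= -!nth_w /= eq_ic.
Qed.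

(* Subtrees hanging to the left of the root 0 of the trees in [inc_ttrees' n k]. *)
Definition left_ttrees (n k : nat) : set ttree :=
  [set t | [/\ tincreasing t, perm_eq (tlabels t) (iota 1 n) &
               ~~ tempty t + tleft_edges t = k]].

(** * The three families as injective images of [left_ttrees] *)

Lemma inc_ttrees'E n k :
  inc_ttrees' n k = (fun t => TNode 0 t TEmpty TEmpty) @` left_ttrees n k.
Proof.
apply/seteqP; split=> [t [inc pt eqk]|_ [t [inc pt eqk] <-]].
  case: t pt inc eqk => [/perm_size//|x l [|? ? ? ?] [|? ? ? ?]] // pt inc.
  rewrite /= !addn0 => eqk _.
  have eqx : x = 0.
    by apply/eqP; rewrite -leqn0 (tnode_min inc) // (perm_mem pt) inE.
  rewrite {}eqx in pt inc *; exists l => //; split=> //.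
    by case: (tincreasing_node_inv inc).
  by move: pt; rewrite /= !cats0 perm_cons.
split=> //=; rewrite ?cats0 ?perm_cons ?addn0 // inc !andbT.
by apply: troot_gt_all; apply/allP => y; rewrite (perm_mem pt) mem_iota => /andP[].
Qed.

Lemma tforest_olp t : tincreasing t -> all olarger_than_parent (tforest t).
Proof.
elim: t => //= x l IHl m IHm r IHr.
move=> /and5P[gtl _ _ incl /andP[incm incr]].
rewrite all_cat /= IHm // IHr // andbT /=.
have := IHl incl; have := tlabels_gt incl gtl.
rewrite -(perm_all _ (perm_tforest l)) => /allP gtx olp.
have : all (ltn x) (map oroot (tforest l)).
  by apply/allP => y /oroot_olabels/gtx.
by rewrite all_map => gt; rewrite (all_predI (preim oroot (ltn x))) gt.
Qed.

Lemma size_tforest_gt0 t : (0 < size (tforest t)) = ~~ tempty t.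
Proof. by case: t => //= *; rewrite size_cat addnS. Qed.

(** The children of [x] in the forest are the trees of F(l), so [x] is internal exactly when it has
    a left edge. *)
Lemma ointernal_tforest t :
  sumn (map ointernal (tforest t)) = tleft_edges t.
Proof.
elim: t => //= x l IHl m IHm r IHr.
rewrite map_cat sumn_cat /= IHl IHm IHr size_tforest_gt0; lia.
Qed.

Lemma inc_otreesE n k :
  inc_otrees n k = (fun t => ONode 0 (tforest t)) @` left_ttrees n k.
Proof.
apply/seteqP; split=> [[x ts] [/andP[uts olp] pts eqk]|_ [t [inc pt eqk] <-]].
  have uf : uniq (flatten (map olabels ts)) by case/andP: uts.
  have [gt_ts olp_ts] : all (ltn x) (map oroot ts) /\ all olarger_than_parent ts.
    rewrite all_map; split; first by apply: sub_all olp => c /andP[].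
    by apply: sub_all olp => c /andP[].
  have [t inc eqt] := tforest_surj uf olp_ts.
  have eqx : x = 0.
    have := perm_mem pts 0; rewrite !inE => /predU1P[//|].
    rewrite -eqt (perm_mem (perm_tforest t)) => t0.
    have /(tlabels_gt inc)/allP/(_ _ t0) // : troot_gt x t.
    by apply: troot_gt_tforest; rewrite eqt.
  rewrite {x}eqx in uts olp pts eqk gt_ts *.
  exists t; rewrite ?eqt //; split=> //.
    rewrite -(permPl (perm_tforest t)) eqt.
    by move: pts; rewrite /= perm_cons.
  by rewrite -ointernal_tforest -size_tforest_gt0 eqt.
have pf : perm_eq (olabels (ONode 0 (tforest t))) (iota 0 n.+1).
  by rewrite /= perm_cons (permPl (perm_tforest t)).
split=> //; last by rewrite /= size_tforest_gt0 ointernal_tforest.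
rewrite /oincreasing (perm_uniq pf) iota_uniq.
have gt0 : troot_gt 0 t.
  by apply: troot_gt_all; apply/allP => y; rewrite (perm_mem pt) mem_iota => /andP[].
(* The forest of this tree consists of the single tree [ONode 0 (tforest t)], so [tforest_olp]
   applies to it. *)
have inc0 : tincreasing (TNode 0 t TEmpty TEmpty) by rewrite /= gt0 inc.
by have /andP[] := tforest_olp inc0.
Qed.

(** By [asc_left], ascents and left edges, with the edge from the root 0 included, add up to [n]. As
    [k <= n], having [n - k] ascents then amounts to having [k] left edges. *)
Lemma stirling_wordsE n k : k <= n ->
  (fun w : n.*2.-tuple 'I_n.+1 => map val w) @`
    [set w | stirling_perm w /\ ascents w = n - k] = tword @` left_ttrees n k.
Proof.
move=> le_kn; have asc_left (w : n.*2.-tuple 'I_n.+1) t : tincreasing t ->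
    perm_eq (tlabels t) (iota 1 n) -> map val w = tword t ->
    ascents w + (~~ tempty t + tleft_edges t) = n.
  move=> inc pt eqw; have pos y : y \in tlabels t -> 0 < y.
    by rewrite (perm_mem pt) mem_iota => /andP[].
  have szt : size (tlabels t) = n by rewrite (perm_size pt) size_iota.
  (* The edge from the root 0 accounts for the ascent that [ascentsE] adds in front. *)
  have -> : ~~ tempty t = (0 < n) by rewrite -szt; case: (t).
  rewrite addnA ascentsE eqw; last first.
    by rewrite mem_tword; apply/negP => /pos.
  by rewrite tword_ascents //; apply/troot_gt_all/allP.
apply/seteqP; split=> [_ [w [/stirling_permP[pw stw] asc_w] <-]|_ [t [inc pt eqk] <-]].
  have [t inc eqt] := tword_surj stw; exists t => //.
  have pt : perm_eq (tlabels t) (iota 1 n).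
    by rewrite -perm_cat_self -(permPl (perm_tword t)) eqt.
  by split=> //; have := asc_left w t inc pt (esym eqt); lia.
have sz : size (tword t) == n.*2.
  by rewrite (perm_size (perm_tword t)) size_cat (perm_size pt) size_iota addnn.
(* The letters of [tword t] are at most [n], so [inord] preserves their values. *)
have szo : size (map (@inord n) (tword t)) == n.*2 by rewrite size_map.
have eqw : map val (Tuple szo) = tword t.
  rewrite /= -map_comp map_id_in // => y; rewrite mem_tword (perm_mem pt).
  by rewrite mem_iota add1n => /andP[_ lt_y] /=; rewrite inordK.
exists (Tuple szo) => //; split; last first.
  by have := asc_left _ _ inc pt eqw; lia.
apply/stirling_permP; rewrite eqw; split.
  by rewrite (permPl (perm_tword t)) perm_cat_self.
by apply: tword_stirling => //; rewrite (perm_uniq pt) iota_uniq.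
Qed.

(** * Cardinalities *)

Lemma card_set_finpred (T : finType) (A : pred T) : [set` A] #= `I_#|A|.
Proof.
rewrite (card_eqr card_II); apply/card_esym.
have -> : [set` A] = (@enum_val T A) @` [set: 'I_#|A|].
  apply/seteqP; split=> [x Ax|_ [i _ <-]]; last exact: enum_valP.
  by exists (enum_rank_in Ax x) => //; rewrite enum_rankK_in.
by apply/card_esym/inj_card_eq => i j _ _; apply: enum_val_inj.
Qed.

Unset Implicit Arguments.

(* A #= B : A and B are in bijection; `I_m is the set of naturals below m. *)
Theorem proposition4p5 (n k : nat) (hkn : k <= n) :
  inc_otrees n k #= inc_ttrees' n k /\
  inc_ttrees' n k #= `I_(eulerian2 n (n - k)).
Proof.
have left_uniq t : t \in left_ttrees n k -> tincreasing t /\ uniq (tlabels t).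
  by rewrite inE => -[inc pt _]; rewrite (perm_uniq pt) iota_uniq.
have card_t : inc_ttrees' n k #= left_ttrees n k.
  by rewrite inc_ttrees'E; apply: inj_card_eq => t t' _ _ [].
have card_o : inc_otrees n k #= left_ttrees n k.
  rewrite inc_otreesE; apply: inj_card_eq.
  move=> t t' /left_uniq[inc u] /left_uniq[inc' u'] [].
  exact: tforest_inj.
split; first exact/(card_eq_trans card_o)/card_esym.
apply: card_eq_trans card_t _.
have card_w : tword @` left_ttrees n k #= left_ttrees n k.
  apply: inj_card_eq => t t' /left_uniq[inc u] /left_uniq[inc' u'].
  exact: tword_inj.
apply: card_eq_trans (card_esym card_w) _; rewrite -stirling_wordsE //.
(* Reading the letters as naturals is injective on tuples, so the tuples counted by [eulerian2] can
   replace their words. *)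
apply: card_eq_trans (inj_card_eq _) _.
  by move=> w w' _ _ /inj_map eqw; apply/val_inj/eqw/val_inj.
rewrite /eulerian2; set E := finset _.
suff -> : [set w | stirling_perm w /\ ascents w = n - k] = [set` mem E].
  exact: card_set_finpred.
apply/seteqP; split=> w /=; rewrite inE; first by case=> -> ->; rewrite eqxx.
by case/andP=> -> /eqP->.
Qed.
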